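(* Distinct vertices $u$ and $v$ are twins in $X$ if and only if there exists an involution on $X$ that switches $u$ and $v$ and fixes all other vertices.
   Context: $X$ is a finite connected undirected graph with nonzero real edge weights, loops allowed, no multiple edges; $(A)_{j,\ell}$ is the weight of the edge $(j,\ell)$ (for $j=\ell$, of the loop at $j$), and $0$ if there is no such edge. Distinct vertices $u,v$ are twins if they have the same neighbours outside $\{u,v\}$, $(A)_{u,w}=(A)_{v,w}$ for every $w\neq u,v$, and $(A)_{u,u}=(A)_{v,v}$. An involution on $X$ is an automorphism $g$ of $X$ of order two, where an automorphism is a permutation of $V(X)$ preserving adjacency and all edge and loop weights. *)

(* Defs.v *)
From HB Require Import structures.
From mathcomp Require Import all_boot all_order all_fingroup all_algebra.
From mathcomp Require Import reals.

Set Implicit Arguments.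
Unset Strict Implicit.
Unset Printing Implicit Defensive.

Import GRing.Theory.
Local Open Scope ring_scope.

(* [adj u u] means that there is a loop at [u]. The function [weight] is only
   meaningful on edges: its values at non-adjacent pairs are unconstrained and
   never used. *)
Record wgraph (R : realType) (V : finType) := WGraph {
  adj : rel V;
  weight : V -> V -> R;
  adj_sym : symmetric adj;
  weight_sym : forall j l, adj j l -> weight j l = weight l j;
  weight_neq0 : forall j l, adj j l -> weight j l != 0;
  adj_connected : forall j l, connect adj j l
}.

Section WeightedGraphs.

Variables (R : realType) (V : finType) (X : wgraph R V).

(* The adjacency matrix, with rows and columns indexed by the vertices. *)
Definition adjmat (j l : V) : R := if adj X j l then weight X j l else 0.

Definition neighbours (u : V) : {set V} := [set w | adj X u w].

Definition twins (u v : V) : Prop :=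
  [/\ u != v,
      neighbours u :\: [set u; v] = neighbours v :\: [set u; v],
      (forall w, w != u -> w != v -> adjmat u w = adjmat v w)
    & adjmat u u = adjmat v v].

Definition automorphism (g : {perm V}) : Prop :=
  (forall j l, adj X (g j) (g l) = adj X j l) /\
  (forall j l, adj X j l -> weight X (g j) (g l) = weight X j l).

Definition involution (g : {perm V}) : Prop :=
  automorphism g /\ #[g]%g = 2%N.

End WeightedGraphs.

(* Main.v *)
Require Import Defs.
From mathcomp Require Import all_boot all_order all_fingroup all_algebra.
From mathcomp Require Import cyclic reals.

(** Because edge weights are nonzero, the adjacency matrix [A] determines the
    graph: [adj j l] holds exactly when [A j l] is nonzero. Hence automorphisms
    are the permutations preserving [A] ([automorphism_adjmat]), and the
    condition on neighbourhoods in the definition of twins follows from the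
    equality of the matrix entries ([twins_adjmat]).

    A permutation that switches [u] and [v] and fixes the other vertices is the
    transposition [tperm u v], which has order two. It preserves [A] at [(u, w)]
    and at [(u, u)] exactly when [A u w = A v w] and [A u u = A v v]; at [(u, v)]
    it does so because [A] is symmetric. Pairs avoiding both [u] and [v] are
    fixed, and the remaining ones reduce to these by symmetry of [A] and by
    exchanging [u] and [v]. *)

Section Twins.

Variables (R : realType) (V : finType) (X : wgraph R V).
Implicit Types (g : {perm V}) (u v w j l : V).

Lemma adj_adjmat j l : adj X j l = (adjmat X j l != 0%R).
Proof.
rewrite /adjmat; case: ifP => [jl | _]; last by rewrite eqxx.
by rewrite (weight_neq0 jl).
Qed.

Lemma adjmatC j l : adjmat X j l = adjmat X l j.
Proof.
rewrite /adjmat (@adj_sym _ _ X l j); case: ifP => // jl.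
exact: weight_sym.
Qed.

(** Preserving [A] preserves adjacency, since the edges are the nonzero entries
    of [A]; this makes both clauses in the definition of automorphisms
    consequences of a single family of equations. *)
Lemma automorphism_adjmat g :
  automorphism X g <-> forall j l, adjmat X (g j) (g l) = adjmat X j l.
Proof.
split=> [[gadj gwt] j l | gA].
  by rewrite /adjmat gadj; case: ifP => // /gwt.
have gadj j l : adj X (g j) (g l) = adj X j l by rewrite !adj_adjmat gA.
split=> // j l jl.
by have := gA j l; rewrite /adjmat gadj jl.
Qed.

(** Outside [u] and [v], equal entries of [A] are simultaneously nonzero, so
    equality of the rows already gives equality of the neighbourhoods. *)
Lemma twins_adjmat u v : u != v ->
  twins X u v <->
  (forall w, w != u -> w != v -> adjmat X u w = adjmat X v w)
  /\ adjmat X u u = adjmat X v v.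
Proof.
move=> uv; split=> [[_ _ Aw Au] | [Aw Au]]; first by split.
split=> //; apply/setP=> w; rewrite !inE negb_or.
case: (eqVneq w u) => //= wu; case: (eqVneq w v) => //= wv.
by rewrite !adj_adjmat Aw.
Qed.

(** Each invariance equation of [A] under the transposition is trivial, an
    instance of the symmetry of [A], or, up to that symmetry, one of the
    equations [A u w = A v w] and [A u u = A v v]. *)
Lemma twins_automorphism_tperm u v : u != v ->
  twins X u v <-> automorphism X (tperm u v).
Proof.
move=> uv; split=> [/(twins_adjmat _ _ uv)[Aw Au] | /automorphism_adjmat tA].
  apply/automorphism_adjmat=> j l.
  case: (tpermP u v j) => [-> | -> | /eqP ju /eqP jv];
    case: (tpermP u v l) => [-> | -> | /eqP lu /eqP lv] //.
  - exact: adjmatC.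
  - by rewrite Aw.
  - exact: adjmatC.
  - by rewrite Aw.
  - by rewrite adjmatC -Aw // adjmatC.
  - by rewrite adjmatC Aw // adjmatC.
apply/(twins_adjmat _ _ uv); split=> [w wu wv |].
  by rewrite -(tA u w) tpermL tpermD // eq_sym.
by rewrite -(tA u u) tpermL.
Qed.

End Twins.

Lemma order_tperm (T : finType) (x y : T) : x != y -> #[tperm x y]%g = 2.
Proof.
move=> xy; apply: nt_prime_order => //; first by rewrite expgS expg1 tperm2.
apply: contraNneq xy => /permP/(_ x).
by rewrite tpermL perm1 => ->.
Qed.

Lemma eq_tperm (T : finType) (x y : T) (g : {perm T}) :
    g x = y -> g y = x -> (forall z, z != x -> z != y -> g z = z) ->
  g = tperm x y.
Proof.
move=> gx gy gz; apply/permP=> z.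
by case: tpermP => [-> | -> | /eqP zx /eqP zy] //; apply: gz.
Qed.

Theorem lemma2p10 (R : realType) (V : finType) (X : wgraph R V) (u v : V)
    (huv : u != v) :
  twins X u v <->
  exists g : {perm V},
    [/\ involution X g, g u = v, g v = u
      & forall w : V, w != u -> w != v -> g w = w].
Proof.
split=> [/(twins_automorphism_tperm _ _ _ _ _ huv) tw |].
  exists (tperm u v); split; rewrite ?tpermL ?tpermR //.
    by split=> //; apply: order_tperm.
  by move=> w wu wv; rewrite tpermD // eq_sym.
case=> g [[autg _] gu gv gw].
apply/(twins_automorphism_tperm _ _ _ _ _ huv).
by rewrite -(eq_tperm _ _ _ _ gu gv gw).
Qed.
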